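(* Let $K$ be a metric space, $f\in SD(K)$ real-valued, and $\varepsilon>0$. There exist non-negative lower semi-continuous functions $u,v$ belonging to $SD(K)$ such that $$f=u-v\quad\text{and}\quad\|u+v\|_\infty\le\|f\|_D+\varepsilon .$$
   Context: $D(K)$ is the set of all $f:K\to\mathbb{C}$ of the form $f=(\varphi_1-\varphi_2)+i(\varphi_3-\varphi_4)$ with $\varphi_1,\dots,\varphi_4$ bounded real-valued lower semi-continuous functions on $K$. Equivalently, $f\in D(K)$ iff there is a sequence $(\varphi_j)$ of continuous complex-valued functions on $K$ with $\sup_{k\in K}\sum_j|\varphi_j(k)|<\infty$ and $f=\sum_j\varphi_j$ pointwise; $\|f\|_D$ is the infimum of $\sup_{k\in K}\sum_j|\varphi_j(k)|$ over all such sequences. A function is simple if its range is finite. $SD(K)$ is the closure, in $(D(K),\|\cdot\|_D)$, of the set of simple functions belonging to $D(K)$. $\|\cdot\|_\infty$ is the sup norm. *)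

(* Defs.v *)
From HB Require Import structures.
From mathcomp Require Import all_boot all_order all_algebra.
From mathcomp Require Import all_classical all_reals all_analysis.
From mathcomp Require Import complex.
Set Implicit Arguments.
Unset Strict Implicit.
Unset Printing Implicit Defensive.
Import Order.TTheory GRing.Theory Num.Theory numFieldNormedType.Exports.
Import ComplexField.Normc.

Local Open Scope classical_set_scope.
Local Open Scope ring_scope.
Local Open Scope complex_scope.

Definition lsc (R : realType) (K : topologicalType) (u : K -> R) : Prop :=
  lower_semicontinuous (EFin \o u).

(* Supremum of a nonnegative function; the added 0 only matters when K is
   empty, where it gives the value 0 instead of -oo. *)
Definition esup (R : realType) (K : Type) (h : K -> \bar R) : \bar R :=
  ereal_sup (0%E |` range h).

Definition supnorm (R : realType) (K : Type) (u : K -> R) : \bar R :=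
  esup (fun k => `|u k|%:E).

Definition inD (R : realType) (K : topologicalType) (f : K -> R[i]) : Prop :=
  exists p1 p2 p3 p4 : K -> R,
    [/\ bounded_fun p1 /\ lsc p1,
        bounded_fun p2 /\ lsc p2,
        bounded_fun p3 /\ lsc p3,
        bounded_fun p4 /\ lsc p4
      & forall k, f k = (p1 k - p2 k) +i* (p3 k - p4 k)].

Definition abs_total (R : realType) (K : Type) (phi : nat -> K -> R[i]) :
    \bar R :=
  esup (fun k => \sum_(0 <= j <oo) (normc (phi j k))%:E)%E.

(* R[i]^o carries the topology induced by the complex modulus. *)
Definition D_series (R : realType) (K : topologicalType) (f : K -> R[i])
    (phi : nat -> K -> R[i]) : Prop :=
  [/\ forall j, continuous (phi j : K -> R[i]^o),
      (abs_total phi < +oo)%E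
    & forall k, series (fun j => phi j k : R[i]^o) @ \oo --> (f k : R[i]^o)].

(* Equals +oo when f has no such series, i.e. (for K metric) outside D(K). *)
Definition Dnorm (R : realType) (K : topologicalType) (f : K -> R[i]) :
    \bar R :=
  ereal_inf [set abs_total phi | phi in D_series f].

Definition simple_fun (R : realType) (K : Type) (f : K -> R[i]) : Prop :=
  finite_set (range f).

Definition inSD (R : realType) (K : topologicalType) (f : K -> R[i]) : Prop :=
  inD f /\
  forall e : R, 0 < e -> exists g : K -> R[i],
    [/\ inD g, simple_fun g & (Dnorm (fun k => f k - g k)%R < e%:E)%E].

(* Main.v *)
Require Import Defs.
From HB Require Import structures.
From mathcomp Require Import all_boot all_order all_algebra.
From mathcomp Require Import all_classical all_reals all_analysis.
From mathcomp Require Import complex.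
From mathcomp Require Import ring lra.
Import Order.TTheory GRing.Theory Num.Theory numFieldNormedType.Exports.

Local Open Scope classical_set_scope.
Local Open Scope ring_scope.
Local Open Scope complex_scope.

(** A real [f] has [‖f‖_D < M] only if [f = U - V] with [U, V >= 0] lower
    semi-continuous and [U + V <= M] (positive and negative parts of the
    series), and on a metric space such a decomposition gives back
    [‖f‖_D <= M] (inf-convolutions).  If moreover [f] has finite range, put
    [w = M - (U + V)]: then [w + f] and [w - f] are upper semi-continuous, and
    they remain so when [w] is replaced by the largest element below [w] of
    the additive semigroup generated by the numbers [|f x - f y|], because
    that semigroup is locally finite.  Hence [U] and [V] may be taken with
    finite range.  In general write [f] as a [D]-norm convergent series of
    functions with finite range and sum their decompositions; the tails of the
    two resulting series are small non-negative lower semi-continuous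
    functions, hence of small [D]-norm. *)

(** * Lower semi-continuous functions and their sums *)

Lemma lscP {R : realType} {K : topologicalType} (u : K -> R) :
  lsc u <-> forall x a, a < u x -> \forall y \near x, a < u y.
Proof.
split=> [h x a axu|h x a /=]; last first.
  by rewrite lte_fin => /h nx; exists [set y | a < u y] => // y; rewrite lte_fin.
have [|V xV hV] := h x a; first by rewrite lte_fin.
by apply: filterS xV => y /hV /=; rewrite lte_fin.
Qed.

Lemma lscD {R : realType} {K : topologicalType} (u v : K -> R) :
  lsc u -> lsc v -> lsc (fun k => u k + v k).
Proof.
move=> /lscP hu /lscP hv; apply/lscP => x a auv.
pose d := (u x + v x - a) / 2.
have := hu x (u x - d) ltac:(rewrite /d; lra).
have := hv x (v x - d) ltac:(rewrite /d; lra).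
apply: filterS2 => y; rewrite /d; lra.
Qed.

Lemma lsc_cst {R : realType} {K : topologicalType} (c : R) :
  lsc (fun _ : K => c).
Proof. by apply/lscP => x a ac; near=> y. Unshelve. all: by end_near. Qed.

Lemma continuous_lsc {R : realType} {K : topologicalType} (u : K -> R) :
  continuous u -> lsc u.
Proof.
move=> cu; apply/lscP => x a aux.
have /cvgrPdist_lt/(_ (u x - a)) := cu x.
rewrite subr_gt0 => /(_ aux); apply: filterS => y.
by rewrite ltr_norml => /andP[]; lra.
Qed.

Lemma lsc_series {R : realType} {K : topologicalType} (U : nat -> K -> R) n :
  (forall j, lsc (U j)) -> lsc (fun k => series (U^~ k) n).
Proof.
move=> lU; elim: n => [|n ih].
  by rewrite /series/=; under eq_fun do rewrite big_geq//; exact: lsc_cst.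
rewrite /series/=; under eq_fun do rewrite big_nat_recr//=.
exact: lscD.
Qed.

(** The partial sums increase to [u]: if [u x] exceeds [a], then some partial sum already does at
    [x], hence near [x], and [u] lies above it. *)
Lemma lsc_lim_series {R : realType} {K : topologicalType} (U : nat -> K -> R)
    (u : K -> R) :
  (forall j, lsc (U j)) -> (forall j k, 0 <= U j k) ->
  (forall k, series (U^~ k) @ \oo --> u k) -> lsc u.
Proof.
move=> lU U0 Uu; apply/lscP => x a aux.
have ndU k : {homo series (U^~ k) : n m / (n <= m)%N >-> n <= m}.
  by apply/nondecreasing_seqP => n; rewrite /series/= big_nat_recr//= lerDl.
have /cvgrPdist_lt/(_ (u x - a)) := Uu x.
rewrite subr_gt0 => /(_ aux) [n _ /(_ n (leqnn n))] /= hn.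
have {}hn : a < series (U^~ x) n by move: hn; rewrite ltr_norml => /andP[]; lra.
have /lscP/(_ x a hn) := lsc_series U n lU.
apply: filterS => y /lt_le_trans; apply.
rewrite -(cvg_lim _ (Uu y))//; apply: nondecreasing_cvgn_le => //.
by apply: (cvgP (u y)); exact: Uu.
Qed.

(** * Real and complex series *)

Lemma nneg_series_cvg {R : realType} (c : nat -> R) (M : R) :
  (forall j, 0 <= c j) -> (forall n, series c n <= M) -> cvgn (series c).
Proof.
move=> c0 cM; apply: nondecreasing_is_cvgn.
  by apply/nondecreasing_seqP => n; rewrite /series/= big_nat_recr//= lerDl.
by exists M => _ [n _ <-].
Qed.

Lemma cvg_le_cst {R : realType} (c : nat -> R) (l M : R) :
  c @ \oo --> l -> (forall n, c n <= M) -> l <= M.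
Proof.
move=> cl cM; rewrite -(cvg_lim _ cl)//; apply: limr_le; first exact: cvgP cl.
by near=> n. Unshelve. all: by end_near.
Qed.

Lemma cvg_ge_cst {R : realType} (c : nat -> R) (l M : R) :
  c @ \oo --> l -> (forall n, M <= c n) -> M <= l.
Proof.
move=> cl cM; rewrite -(cvg_lim _ cl)//; apply: limr_ge; first exact: cvgP cl.
by near=> n. Unshelve. all: by end_near.
Qed.

Lemma cvg_Re {R : realType} {T : Type} {F : set_system T} {FF : Filter F}
    (h : T -> R[i]) (l : R[i]) :
  (h : T -> R[i]^o) @ F --> (l : R[i]^o) ->
  complex.Re (h t) @[t --> F] --> complex.Re l.
Proof.
move=> /(@cvgrPdist_lt _ R[i]^o) hl; apply/cvgrPdist_lt => e e0.
have := hl e%:C; rewrite ltcR => /(_ e0); apply: filterS => t.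
by rewrite -ltcR; apply: le_lt_trans; rewrite -raddfB; exact: normc_ge_Re.
Qed.

Lemma cvg_realC {R : realType} {T : Type} {F : set_system T} {FF : Filter F}
    (h : T -> R) (l : R) :
  h @ F --> l -> (h t)%:C%C @[t --> F] --> (l%:C : R[i]^o).
Proof.
move=> /cvgrPdist_lt hl; apply/(@cvgrPdist_lt _ R[i]^o) => e e0.
(* A positive complex tolerance is real, hence the image of its real part. *)
have eE : e = (complex.Re e)%:C by rewrite RRe_real// ger0_real// ltW.
have := hl (complex.Re e); rewrite -ltcR -eE => /(_ e0); apply: filterS => t.
by rewrite -ltcR -eE -rmorphB/= normc_def/= expr0n addr0 sqrtr_sqr.
Qed.

(** With the converse [abs_total_le] for [0 <= M], this trades an extended-real supremum of infinite
    sums for a real bound on all partial sums. *)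
Lemma series_le_abs_total {R : realType} {K : Type} (phi : nat -> K -> R[i])
    (M : R) :
  (abs_total phi <= M%:E)%E ->
  forall k n, series (fun j => Normc.normc (phi j k)) n <= M.
Proof.
move=> phiM k n; rewrite -lee_fin; apply: le_trans phiM.
apply: (@le_trans _ _ (\sum_(0 <= j <oo) (Normc.normc (phi j k))%:E)%E).
  rewrite /series/= -sumEFin; apply: nneseries_lim_ge => i _ _.
  by rewrite lee_fin; case: (phi i k) => a b; exact: sqrtr_ge0.
by apply: ereal_sup_ubound; right; exists k.
Qed.

Lemma abs_total_le {R : realType} {K : Type} (phi : nat -> K -> R[i]) (M : R) :
  0 <= M -> (forall k n, series (fun j => Normc.normc (phi j k)) n <= M) ->
  (abs_total phi <= M%:E)%E.
Proof.
move=> M0 phiM; apply: ge_ereal_sup => _ [->|[k _ <-]];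
  first by rewrite lee_fin.
apply: lime_le.
  apply: is_cvg_nneseries => i _ _.
  by rewrite lee_fin; case: (phi i k) => a b; exact: sqrtr_ge0.
by near=> n; rewrite sumEFin lee_fin; exact: phiM.
Unshelve. all: by end_near. Qed.

(** * Differences of non-negative lower semi-continuous functions *)

Definition lsc_diff {R : realType} {K : topologicalType} (g : K -> R) (M : R) :=
  exists U V : K -> R,
    [/\ lsc U /\ lsc V, (forall k, 0 <= U k) /\ (forall k, 0 <= V k),
        forall k, g k = U k - V k & forall k, U k + V k <= M].

Lemma lsc_diffD {R : realType} {K : topologicalType} (g h : K -> R) (a b : R) :
  lsc_diff g a -> lsc_diff h b -> lsc_diff (fun k => g k + h k) (a + b).
Proof.
move=> [U [V [[lU lV] [U0 V0] gE gM]]] [W [X [[lW lX] [W0 X0] hE hM]]].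
exists (fun k => U k + W k), (fun k => V k + X k).
split; [by split; exact: lscD|by split=> k; exact: addr_ge0| |] => k.
  by rewrite gE hE; ring.
by have := gM k; have := hM k; lra.
Qed.

Lemma lsc_diffN {R : realType} {K : topologicalType} (g : K -> R) (a : R) :
  lsc_diff g a -> lsc_diff (fun k => - g k) a.
Proof.
move=> [U [V [[lU lV] [U0 V0] gE gM]]]; exists V, U; split=> // k.
  by rewrite gE opprB.
by rewrite addrC.
Qed.

Lemma lsc_diff_norm {R : realType} {K : topologicalType} (g : K -> R)
    (a : R) k :
  lsc_diff g a -> `|g k| <= a.
Proof.
move=> [U [V [_ [U0 V0] gE gM]]]; have := gM k; have := U0 k; have := V0 k.
by rewrite gE ler_norml => ? ? ?; apply/andP; split; lra.
Qed.

(** Together with [Dnorm_le], this lets [lsc_diff] stand in for the norm of a real function on a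
    metric space. A complex [F] is allowed because the simple approximants in [inSD] need not be
    real. *)
Lemma lsc_diff_lt_Dnorm {R : realType} {K : topologicalType} (F : K -> R[i])
    (M : R) : (Dnorm F < M%:E)%E -> lsc_diff (fun k => complex.Re (F k)) M.
Proof.
move=> /ereal_inf_lt[_ [phi [cphi _ Fphi] <-]] /ltW /series_le_abs_total phiM.
pose a j k := complex.Re (phi j k).
have ca j : continuous (a j).
  by move=> k; apply: cvg_Re; exact: cphi.
have aM k n : series (fun j => `|a j k|) n <= M.
  apply: le_trans (phiM k n); apply: ler_sum => j _.
  by have := normc_ge_Re (phi j k); rewrite normc_def lecR /a; case: (phi j k).
have Fa k : series (a^~ k) @ \oo --> complex.Re (F k).
  have -> : series (a^~ k) = fun n => complex.Re (series (fun j => phi j k) n).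
    by apply/funext => n; rewrite /series/= raddf_sum.
  by apply: cvg_Re; exact: Fphi.
(* Positive and negative parts of [a]: [p - q = a] and [p + q = |a|]. *)
pose p j k := (`|a j k| + a j k) / 2; pose q j k := (`|a j k| - a j k) / 2.
have p0 j k : 0 <= p j k.
  by rewrite /p; have := ler_norm (- a j k); rewrite normrN; lra.
have q0 j k : 0 <= q j k by rewrite /q; have := ler_norm (a j k); lra.
have cp k : cvgn (series (p^~ k)).
  apply: (nneg_series_cvg _ M) => // n; apply: le_trans (aM k n).
  by apply: ler_sum => j _; have := q0 j k; rewrite /p /q; lra.
have cq k : cvgn (series (q^~ k)).
  apply: (nneg_series_cvg _ M) => // n; apply: le_trans (aM k n).
  by apply: ler_sum => j _; have := p0 j k; rewrite /p /q; lra.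
have lp j : lsc (p j).
  apply: continuous_lsc => k; apply: cvgMr_tmp; apply: cvgD; last exact: ca.
  by apply: cvg_norm; exact: ca.
have lq j : lsc (q j).
  apply: continuous_lsc => k; apply: cvgMr_tmp; apply: cvgB; last exact: ca.
  by apply: cvg_norm; exact: ca.
exists (fun k => limn (series (p^~ k))), (fun k => limn (series (q^~ k))).
split.
- by split; [apply: (lsc_lim_series p)|apply: (lsc_lim_series q)].
- by split=> k; [apply: (cvg_ge_cst _ _ _ (cp k))|
    apply: (cvg_ge_cst _ _ _ (cq k))];
    move=> n; exact: sumr_ge0.
- move=> k; apply: (cvg_unique _ (Fa k)) => //.
  have -> : series (a^~ k) = series (p^~ k) - series (q^~ k).
    apply/funext => n; rewrite /series/= -[RHS]sumrB.
    by apply: eq_bigr => j _; rewrite /p /q; field.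
  by apply: cvgB; [exact: cp|exact: cq].
- move=> k; apply: (cvg_le_cst _ _ _ (cvgD (cp k) (cq k))) => n.
  apply: le_trans (aM k n); rewrite /series/= -[leLHS]big_split/=.
  by apply: ler_sum => j _; rewrite /p /q; lra.
Qed.

(** * Locally finite additive semigroups and decompositions with finite range *)

Lemma bounded_additive_closure {R : realType} (A : seq R) (M : R) :
  (forall a, a \in A -> 0 <= a) ->
  exists T : seq R, [/\ 0 \in T, forall s, s \in T -> 0 <= s &
    forall s a, s \in T -> a \in A -> s + a <= M -> s + a \in T].
Proof.
elim: A => [|b A ih] A0;
  first by exists [:: 0]; split=> [|s|//]; rewrite inE// => /eqP ->.
have [|T [T0 Tge0 TA]] := ih.
  by move=> a aA; apply: A0; rewrite inE aA orbT.
have b0 : 0 <= b by apply: A0; rewrite mem_head.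
have [b_gt0|b_le0] := ltP 0 b; last first.
  exists T; split=> // s a sT; rewrite inE => /orP[/eqP ->|aA]; last exact: TA.
  by have -> : s + b = s by lra.
(* Fewer than [N] copies of [b] fit below [M] once [n%:R * b <= M] is required, so finitely many
   multiples of [b] suffice to extend [T] to the new generator. *)
pose N := Num.bound `|M / b|.
have NM n : n%:R * b <= M -> (n < N)%N.
  rewrite -ler_pdivlMr// => nM; rewrite -(@ltr_nat R).
  exact: le_lt_trans nM (le_lt_trans (ler_norm _) (archi_boundP (normr_ge0 _))).
pose T' := [seq t + n%:R * b | t <- T, n <- iota 0 N.+1].
exists T'; split.
- apply/allpairsP; exists (0, 0%N) => /=.
  by split; rewrite //= mul0r addr0.
- move=> s /allpairsP[[t n] /= [tT _ ->]].
  by apply: addr_ge0; [exact: Tge0|exact: mulr_ge0].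
move=> _ a /allpairsP[[t n] /= [tT nN ->]] aA leM.
have t0 := Tge0 t tT.
have nb0 : 0 <= n%:R * b by exact: mulr_ge0.
move: aA leM; rewrite inE => /orP[/eqP -> leM|aA leM]; apply/allpairsP.
  have nN' : n.+1 \in iota 0 N.+1.
    by rewrite mem_iota add0n ltnS; apply/ltnW/NM; rewrite -natr1; lra.
  by exists (t, n.+1); split=> //=; rewrite -natr1; ring.
by exists (t + a, n) => /=; split=> //; [apply: TA => //; lra|ring].
Qed.

(** Only finitely many elements of [T] lie above [w], so the nearest one is at a positive distance.
    This gap later turns an inequality with an error term into an exact one. *)
Lemma seq_gap {R : realType} (T : seq R) (w : R) :
  exists2 d, 0 < d & forall s, s \in T -> s < w + d -> s <= w.
Proof.
elim: T => [|t T [d d0 hd]]; first by exists 1.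
exists (if t <= w then d else Num.min d (t - w)).
  by case: ifPn => //; rewrite -ltNge => tw; rewrite lt_min d0/=; lra.
move=> s; rewrite inE => /orP[/eqP ->|sT]; case: ifPn => // tw.
- by rewrite -ltrBlDl lt_min => /andP[_]; lra.
- exact: hd.
by rewrite -ltrBlDl lt_min ltrBlDl => /andP[/(hd _ sT)].
Qed.

(* The witness [fl t] is the largest element [<= t] of the additive semigroup
   generated by [A]. *)
Lemma discrete_floor {R : realType} (A : seq R) (M : R) :
  (forall a, a \in A -> 0 <= a) ->
  exists (T : seq R) (fl : R -> R),
    [/\ forall t, fl t \in T, forall t, 0 <= fl t,
        forall t, 0 <= t -> fl t <= t
      & forall w, w <= M -> exists2 d, 0 < d &
          forall t a, 0 <= t -> a \in A -> t + a < w + d ->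
            fl t + a <= fl w].
Proof.
(* The margin [1] keeps [fl t + a] in range: it is at most [t + a], which is below [w + 1 <= M + 1]
   once [d] is capped by [1]. *)
move=> A0; have [T [T0 Tge0 TA]] := bounded_additive_closure A (M + 1) A0.
(* The default value [0] belongs to [T] but exceeds a negative [t]; hence the condition [0 <= t] for
   [fl t <= t]. *)
pose fl t : R := \big[Num.max/0]_(s <- T | s <= t) s.
have flT t : fl t \in T.
  rewrite /fl big_seq_cond; apply: (big_ind (fun x => x \in T)) => //.
    by move=> x y xT yT; rewrite maxEle; case: ifP.
  by move=> s /andP[].
have fl_le t : 0 <= t -> fl t <= t.
  move=> t0; rewrite /fl; apply: (big_ind (fun x => x <= t)) => // x y xt yt.
  by rewrite ge_max xt.
exists T, fl; split=> // [t|w wM]; first exact: Tge0.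
have [d d0 hd] := seq_gap T w.
exists (Num.min d 1); first by rewrite lt_min d0/=.
move=> t a t0 aA; rewrite -ltrBlDl lt_min => /andP[tad ta1].
have flt := fl_le t t0.
(* The sum [fl t + a] is in [T] and below [w + d], hence at most [w] by the gap, hence at most
   [fl w] by maximality. *)
have sT : fl t + a \in T by apply: TA (flT t) aA _; lra.
have sw : fl t + a <= w by apply: hd => //; lra.
exact: (le_bigmax_seq 0 (fl t + a) (fun s => s <= w) id).
Qed.

Lemma lsc_diff_finite_range {R : realType} {K : topologicalType} (g : K -> R)
    (M : R) :
  finite_set (range g) -> lsc_diff g M ->
  exists U V : K -> R,
    [/\ lsc U /\ lsc V, (forall k, 0 <= U k) /\ (forall k, 0 <= V k),
        finite_set (range U) /\ finite_set (range V),
        forall k, g k = U k - V k & forall k, U k + V k <= M].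
Proof.
move=> /finite_seqP[r rE] [U [V [[lU lV] [U0 V0] gE gM]]].
have gr k : g k \in r by have : range g (g k) by []; rewrite rE.
pose A := [seq `|a - b| | a <- r, b <- r].
have [|T [fl [flT fl0 fl_le hfl]]] := discrete_floor A M.
  by move=> _ /allpairsP[[a b] [_ _ ->]].
pose w k := M - (U k + V k).
have w0 k : 0 <= w k by rewrite subr_ge0.
(* Near [x], neither [fl (w y) + g y] nor [fl (w y) - g y] exceeds its value at [x]. This gives the
   upper semi-continuity of both at once. *)
have flw x : \forall y \near x, fl (w y) + `|g x - g y| <= fl (w x).
  have [|d d0 hd] := hfl (w x).
    by rewrite /w; have := U0 x; have := V0 x; lra.
  (* Since [w + g = M - 2 V] and [w - g = M - 2 U], a drop of less than [d / 2] in [U] and in [V]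
     keeps [w y + |g x - g y|] below [w x + d]. *)
  have /lscP/(_ x (U x - d / 2)) := lU; have /lscP/(_ x (V x - d / 2)) := lV.
  move=> /(_ ltac:(lra)) hV /(_ ltac:(lra)) hU.
  near=> y; apply: hd; [exact: w0|
    by apply/allpairsP; exists (g x, g y); split; rewrite /= ?gr|].
  have Uy : U x - d / 2 < U y by near: y.
  have Vy : V x - d / 2 < V y by near: y.
  rewrite -ltrBrDl ltr_norml /w !gE; apply/andP; split; lra.
have fin (h : K -> R) : (forall k, exists2 p : R * R, p.1 \in T /\ p.2 \in r &
    h k = (M - p.1 + p.2) / 2 \/ h k = (M - p.1 - p.2) / 2) ->
    finite_set (range h).
  move=> hh.
  pose s1 := [seq (M - a + b) / 2 | a <- T, b <- r].
  pose s2 := [seq (M - a - b) / 2 | a <- T, b <- r].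
  apply: (@sub_finite_set _ _ [set` s1 ++ s2]); last exact: finite_seq.
  move=> _ [k _ <-] /=; have [[a b] /= [aT br] [->|->]] := hh k.
    by rewrite mem_cat; apply/orP; left; apply/allpairsP; exists (a, b).
  by rewrite mem_cat; apply/orP; right; apply/allpairsP; exists (a, b).
(* The original pair is given by the same formulas with [w] in place of [fl w]. As [fl w <= w], both
   functions can only grow, and their new sum is [M - fl w <= M]. *)
exists (fun k => (M - fl (w k) + g k) / 2), (fun k => (M - fl (w k) - g k) / 2).
split.
- split; apply/lscP => x a aux; apply: filterS (flw x) => y.
    by have := ler_norm (g x - g y); lra.
  by have := ler_norm (- (g x - g y)); rewrite normrN; lra.
- have h k := fl_le (w k) (w0 k); split=> k; have := h k; rewrite gE /w.
    by have := U0 k; lra.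
  by have := V0 k; lra.
- split; apply: fin => k; exists (fl (w k), g k) => //=; [by left|by right].
- by move=> k; field.
- by move=> k; have := fl0 (w k); lra.
Unshelve. all: by end_near. Qed.

(** * Inf-convolutions and the upper bound for the [D]-norm *)

Section inf_convolution.
Context {R : realType} {K : metricType R} (u : K -> R).
Hypothesis u0 : forall k, 0 <= u k.

(** The Pasch-Hausdorff envelope: the largest [n]-Lipschitz function below [u]. *)
Let conv (n : nat) (x : K) : R := inf (range (fun y => u y + n%:R * mdist x y)).

Let term_ge0 n x y : 0 <= u y + n%:R * mdist x y.
Proof. by rewrite addr_ge0// mulr_ge0// mdist_ge0. Qed.

Let conv_le n x y : conv n x <= u y + n%:R * mdist x y.
Proof. by apply: ge_inf; [exists 0 => _ [z _ <-]|exists y]. Qed.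

Let le_conv n x a : (forall y, a <= u y + n%:R * mdist x y) -> a <= conv n x.
Proof.
move=> h; apply: lb_le_inf => [|_ [y _ <-]//].
by exists (u x + n%:R * mdist x x), x.
Qed.

Let conv_lip n x z : conv n x <= conv n z + n%:R * mdist x z.
Proof.
rewrite -lerBlDr; apply: le_conv => y; rewrite lerBlDr.
apply: le_trans (conv_le n x y) _.
have := ler_wpM2l (ler0n R n) (metric_triangle x z y); lra.
Qed.

Let conv_continuous n : continuous (conv n).
Proof.
move=> x; apply/cvgrPdist_lt => e e0.
(* The divisor is [n.+1] instead of the Lipschitz constant [n], which may be zero. *)
have d0 : 0 < e / n.+1%:R by rewrite divr_gt0.
have := nbhsx_ballx x _ d0; rewrite ballEmdist.
apply: filterS => y /=; rewrite ltr_pdivlMr// mulrC -natr1 => hy.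
have := conv_lip n x y; have := conv_lip n y x; rewrite (metric_sym y x).
by have := mdist_ge0 x y; rewrite ltr_norml => ? ? ?; apply/andP; split; lra.
Qed.

(** The functions [conv n] are continuous and increase to [u]; the series consists of [conv 0]
    followed by the successive differences. *)
Lemma lsc_series_continuous : lsc u ->
  exists phi : nat -> K -> R,
    [/\ forall j, continuous (phi j), forall j k, 0 <= phi j k
      & forall k, series (phi^~ k) @ \oo --> u k].
Proof.
move=> /lscP lu.
pose phi j := if j is i.+1 then fun k => conv i.+1 k - conv i k else conv 0.
have phiE k n : series (phi^~ k) n.+1 = conv n k.
  rewrite /series/=; elim: n => [|n ih]; first by rewrite big_nat1.
  by rewrite big_nat_recr//= ih; ring.
exists phi; split.
- case=> [|j]; first exact: conv_continuous.
  by move=> x; apply: cvgB; exact: conv_continuous.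
- case=> [|j] k /=; first exact: le_conv.
  rewrite subr_ge0; apply: le_conv => y; apply: le_trans (conv_le j k y) _.
  by rewrite lerD2l ler_wpM2r ?mdist_ge0// ler_nat.
- move=> x; rewrite -cvg_shiftS; apply/cvgrPdist_le => e e0.
  have [d /= d0 hd] : nbhs_ball x (fun y => u x - e < u y).
    by rewrite nbhs_ballE; apply: lu; lra.
  near=> n; rewrite /= phiE.
  (* For such [n], points at distance at least [d] contribute at least [u x] to the infimum, while
     at closer points [u] itself exceeds [u x - e]. *)
  have nd : u x <= n%:R * d.
    rewrite -ler_pdivrMr//.
    by near: n; exact: nbhs_infty_ger.
  have le1 : conv n x <= u x.
    by have := conv_le n x x; rewrite mdistxx mulr0 addr0.
  have le2 : u x - e <= conv n x.
    apply: le_conv => y; have [xy|xy] := ltP (mdist x y) d.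
      have /ltW : u x - e < u y by apply: hd; rewrite ballEmdist.
      by have := mulr_ge0 (ler0n R n) (mdist_ge0 x y); lra.
    have := ler_wpM2l (ler0n R n) xy; have := u0 y; lra.
  by rewrite ger0_norm; lra.
Unshelve. all: by end_near. Qed.

End inf_convolution.

(** Expand [U] and [V] into continuous non-negative terms [p j] and [q j]. The series of [p j - q j]
    represents [g], and its absolute sums are at most [U + V]. *)
Lemma Dnorm_le {R : realType} {K : metricType R} (g : K -> R) (M : R) :
  0 <= M -> lsc_diff g M -> (Dnorm (fun k => (g k)%:C) <= M%:E)%E.
Proof.
move=> M0 [U [V [[lU lV] [U0 V0] gE gM]]].
have [p [cp p0 Up]] := lsc_series_continuous U U0 lU.
have [q [cq q0 Vq]] := lsc_series_continuous V V0 lV.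
pose phi j k : R[i] := (p j k - q j k)%:C.
have phiM : (abs_total phi <= M%:E)%E.
  apply: abs_total_le => // k n.
  apply: (@le_trans _ _ (series (p^~ k) n + series (q^~ k) n)).
    rewrite /series/= -big_split/=; apply: ler_sum => j _.
    rewrite expr0n addr0 sqrtr_sqr ler_norml; have := p0 j k; have := q0 j k.
    by move=> ? ?; apply/andP; split; lra.
  have incr (c : nat -> R) (l : R) : (forall j, 0 <= c j) ->
      series c @ \oo --> l -> series c n <= l.
    move=> c0 cl; rewrite -(cvg_lim _ cl)//; apply: nondecreasing_cvgn_le.
      by apply/nondecreasing_seqP => m; rewrite /series/= big_nat_recr//= lerDl.
    exact: cvgP cl.
  by have := gM k; have := incr _ _ (p0^~ k) (Up k);
    have := incr _ _ (q0^~ k) (Vq k); lra.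
apply: (le_trans _ phiM); apply: ereal_inf_lbound; exists phi => //; split.
- by move=> j k; apply: cvg_realC; apply: cvgB; [exact: cp|exact: cq].
- exact: le_lt_trans phiM (ltry _).
- move=> k.
  have -> : series (fun j => phi j k : R[i]^o) =
      fun n => (series (p^~ k) n - series (q^~ k) n)%:C.
    apply/funext => n; rewrite /series/= -sumrB rmorph_sum.
    by apply: eq_bigr.
  by rewrite gE; apply: cvg_realC; apply: cvgB; [exact: Up|exact: Vq].
Qed.

(** * Membership in [D(K)] and [SD(K)] *)

Lemma bounded_fun_le {R : realType} {K : topologicalType} (u : K -> R) (M : R) :
  (forall k, `|u k| <= M) -> bounded_fun u.
Proof.
move=> uM; exists M; split; first exact: num_real.
by move=> x Mx k _; exact: le_trans (uM k) (ltW Mx).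
Qed.

Lemma inD_lsc {R : realType} {K : topologicalType} (u : K -> R) (M : R) :
  (forall k, 0 <= u k) -> (forall k, u k <= M) -> lsc u ->
  inD (fun k => (u k)%:C).
Proof.
move=> u0 uM lu; exists u, (fun=> 0), (fun=> 0), (fun=> 0).
have b0 : bounded_fun (fun _ : K => 0 : R) /\ lsc (fun _ : K => 0 : R).
  split; last exact: lsc_cst.
  by apply: (bounded_fun_le _ 0) => k; rewrite normr0.
split=> //; last by move=> k; rewrite !subr0.
by split=> //; apply: (bounded_fun_le _ M) => k; rewrite ger0_norm.
Qed.

Lemma inD_lsc_diff {R : realType} {K : topologicalType} (F : K -> R[i]) :
  inD F -> exists M, lsc_diff (fun k => complex.Re (F k)) M.
Proof.
have shift (p : K -> R) : bounded_fun p ->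
    exists2 c, 0 <= c & forall k, 0 <= p k + c <= c + c.
  move=> [c [_ hc]]; exists (`|c| + 1) => [|k]; first by rewrite addr_ge0.
  have /hc/(_ k I) : c < `|c| + 1 by have := ler_norm c; lra.
  by rewrite /= ler_norml; lra.
move=> [p1 [p2 [p3 [p4 [[/shift[a a0 ha] l1] [/shift[b b0 hb] l2] _ _ FE]]]]].
(* The common shift [a + b] makes both functions non-negative without changing their difference; the
   shifted sum is at most [3 (a + b)]. *)
exists (4 * (a + b)), (fun k => p1 k + (a + b)), (fun k => p2 k + (a + b)).
split=> [|||k].
- by split; apply: lscD => //; exact: lsc_cst.
- by split=> k; have := ha k; have := hb k; lra.
- by move=> k; rewrite FE/=; ring.
- by have := ha k; have := hb k; lra.
Qed.

Lemma finite_range2 {R : realType} {K : Type} (u v : K -> R)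
    (op : R -> R -> R) :
  finite_set (range u) -> finite_set (range v) ->
  finite_set (range (fun k => op (u k) (v k))).
Proof.
move=> fu fv; apply: sub_finite_set (finite_image2 op fu fv).
by move=> _ [k _ <-]; exists (u k); [exists k|exists (v k); [exists k|]].
Qed.

(** The partial sums are the simple approximants. The remainder is again a sum of non-negative lower
    semi-continuous terms, so its [D]-norm is at most its upper bound, a tail of [series c]. *)
Lemma inSD_lim_series {R : realType} {K : metricType R} (U : nat -> K -> R)
    (c : nat -> R) (C : R) :
  (forall j, lsc (U j)) -> (forall j k, 0 <= U j k) ->
  (forall j, finite_set (range (U j))) ->
  (forall j k, U j k <= c j) -> (forall j, 0 <= c j) ->
  (forall n, series c n <= C) ->
  inSD (fun k => (limn (series (U^~ k)))%:C).
Proof.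
move=> lU U0 fU Uc c0 cC.
have cc : cvgn (series c) by exact: nneg_series_cvg cC.
have UC k n : series (U^~ k) n <= C.
  by apply: le_trans (cC n); apply: ler_sum => j _.
have cU k : cvgn (series (U^~ k)) by exact: nneg_series_cvg (UC k).
set u := fun k => limn (series (U^~ k)).
have lu : lsc u by apply: (lsc_lim_series U).
have u0 k : 0 <= u k.
  by apply: (cvg_ge_cst _ _ _ (cU k)) => n; exact: sumr_ge0.
have uC k : u k <= C by exact: (cvg_le_cst _ _ _ (cU k)).
split; first exact: (inD_lsc u C).
move=> e e0.
have [N _ /(_ N (leqnn N)) /= hN] :=
  (cvgrPdist_lt _ _).1 cc e e0.
pose s k := series (U^~ k) N.
exists (fun k => (s k)%:C); split.
- apply: (inD_lsc s C); [|exact: (UC^~ N)|exact: lsc_series].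
  by move=> k; exact: sumr_ge0.
- suff fs : finite_set (range s).
    apply: sub_finite_set (finite_image (fun x : R => x%:C) fs).
    by move=> _ [k _ <-]; exists (s k) => //; exists k.
  rewrite /s /series/=.
  elim: N {hN s} => [|N ih].
    under eq_fun do rewrite big_geq//.
    by apply: sub_finite_set (finite_set1 (0 : R)) => _ [k _ <-].
  under eq_fun do rewrite big_nat_recr//=.
  exact: finite_range2.
have tailE (a : nat -> R) n :
    series (fun j => a (j + N)%N) n = series a (n + N)%N - series a N.
  elim: n => [|n ih]; first by rewrite /series/= big_geq// subrr.
  by rewrite addSn !seriesSr ih; ring.
have tail (a : nat -> R) : cvgn (series a) ->
    series (fun j => a (j + N)%N) @ \oo --> limn (series a) - series a N.
  move=> ca; rewrite (funext (tailE a)); apply: cvgB; last exact: cvg_cst.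
  by have := ca; rewrite -(cvg_shiftn N).
pose t k := u k - s k.
have lt : lsc t.
  apply: (lsc_lim_series (fun j => U (j + N)%N)) => // k.
  exact: (tail (U^~ k)).
have t0 k : 0 <= t k.
  apply: (cvg_ge_cst _ _ _ (tail _ (cU k))) => n; exact: sumr_ge0.
have lc : 0 <= limn (series c) - series c N.
  apply: (cvg_ge_cst _ _ _ (tail _ cc)) => n; exact: sumr_ge0.
have tc k : t k <= limn (series c) - series c N.
  apply: ler_cvg_to (tail _ (cU k)) (tail _ cc) _.
  by near=> n; apply: ler_sum => j _.
have -> : (fun k => (u k)%:C - (s k)%:C) = (fun k => (t k)%:C).
  by apply/funext => k; rewrite -rmorphB.
apply: (@le_lt_trans _ _ (limn (series c) - series c N)%:E).
  apply: Dnorm_le => //; exists t, (fun=> 0); split.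
  - by split=> //; exact: lsc_cst.
  - by [].
  - by move=> k; rewrite subr0.
  - by move=> k; rewrite addr0.
by rewrite lte_fin; move: hN; rewrite ger0_norm.
Unshelve. all: by end_near. Qed.

(** * The decomposition of a real function in [SD(K)] *)

Theorem proposition4p8 (R : realType) (K : metricType R) (f : K -> R[i])
    (eps : R) (f_SD : inSD f) (f_real : forall k, f k \is Num.real)
    (eps_gt0 : 0 < eps) :
  exists u v : K -> R,
    [/\ (forall k, 0 <= u k) /\ (forall k, 0 <= v k),
        lsc u /\ lsc v,
        inSD (fun k => (u k)%:C) /\ inSD (fun k => (v k)%:C),
        forall k, f k = (u k - v k)%:C
      & (supnorm (fun k => u k + v k)%R <= Dnorm f + eps%:E)%E].
Proof.
pose r k := complex.Re (f k).
have fE k : f k = (r k)%:C by rewrite RRe_real.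
have simpleRe (g : K -> R[i]) :
    simple_fun g -> finite_set (range (fun k => complex.Re (g k))).
  move=> fg; apply: sub_finite_set (finite_image (@complex.Re R) fg).
  by move=> _ [k _ <-]; exists (g k) => //; exists k.
(* The bound [M] for [h] is not controlled by [e]; it serves to show that the norm of [f] is
   finite. *)
have approx e : 0 < e -> exists2 h : K -> R, finite_set (range h) &
    (exists M, lsc_diff h M) /\ lsc_diff (fun k => r k - h k) e.
  move=> e0.
  have [g [/inD_lsc_diff Dg sg /lsc_diff_lt_Dnorm fg]] := f_SD.2 e e0.
  exists (fun k => complex.Re (g k)); first exact: simpleRe.
  split=> //; move: fg; congr lsc_diff; apply/funext => k.
  by rewrite raddfB.
have D0 : (0 <= Dnorm f)%E.
  apply: le_ereal_inf_tmp => _ [phi _ <-].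
  by apply: ereal_sup_ubound; left.
have Dfin : Dnorm f \is a fin_num.
  have [h _ [[M hM] rh]] := approx 1 ltr01.
  (* The absolute value supplies the non-negative bound that [Dnorm_le] asks for; on an empty [K]
     the number [M + 1] could be negative. *)
  have rM : lsc_diff r `|M + 1|.
    have [U [V [l0 p0 rE UM]]] := lsc_diffD _ _ _ _ hM rh.
    exists U, V; split=> // k; first by rewrite -rE /=; ring.
    exact: le_trans (UM k) (ler_norm _).
  rewrite ge0_fin_numE//; apply: le_lt_trans (ltry `|M + 1|).
  rewrite (_ : f = fun k => (r k)%:C); last exact/funext.
  exact: Dnorm_le.
pose N := fine (Dnorm f).
have NE : Dnorm f = N%:E by rewrite fineK.
have N0 : 0 <= N by rewrite -lee_fin -NE.
(* The approximants [h n] start from [h 0 = 0], and [b n] is to bound [r - h n]; hence [N] enters at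
   [n = 0] alone. The increment from [h n] to [h n.+1] then has bound [c n], and these bounds add up
   to [N + 3 eps / 4]. *)
pose b n : R := (if n is 0 then N else 0) + eps / 4 / 2 ^+ n.
have e2 n : 0 < eps / 4 / 2 ^+ n by rewrite divr_gt0 ?exprn_gt0// divr_gt0.
have b0 n : 0 < b n by apply: ltr_wpDl; [case: n|exact: e2].
pose c n := b n + b n.+1.
have c0 n : 0 <= c n by rewrite addr_ge0 ?ltW.
have cS n : series c n <= N + eps.
  have cSE m : series c m.+1 = N + 3 * (eps / 4) - 3 * (eps / 4 / 2 ^+ m.+1).
    rewrite /series/=; elim: m => [|m ih].
      by rewrite big_nat1 /c /b expr0 expr1; field.
    rewrite big_nat_recr//= ih /c /b !exprS; field.
    by rewrite expf_neq0.
  case: n => [|m]; first by rewrite /series/= big_geq//; lra.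
  by rewrite cSE; have := e2 m.+1; lra.
have /choice[h hP] n : exists h : K -> R, [/\ finite_set (range h),
    lsc_diff (fun k => r k - h k) (b n) & n = 0%N -> h = fun=> 0].
  case: n => [|n].
    exists (fun=> 0); split=> //.
      by apply: sub_finite_set (finite_set1 (0 : R)) => _ [k _ <-].
    (* The summand [eps / 4] in [b 0] gives the strict inequality that [lsc_diff_lt_Dnorm]
       requires. *)
    have : (Dnorm f < (b 0%N)%:E)%E.
      by rewrite NE lte_fin /b ltrDl.
    move=> /lsc_diff_lt_Dnorm; congr lsc_diff; apply/funext => k.
    by rewrite subr0.
  by have [h fh [_ rh]] := approx _ (b0 n.+1); exists h.
have UVP n : exists UV : (K -> R) * (K -> R),
    [/\ lsc UV.1 /\ lsc UV.2,
        (forall k, 0 <= UV.1 k) /\ (forall k, 0 <= UV.2 k),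
        finite_set (range UV.1) /\ finite_set (range UV.2),
        forall k, h n.+1 k - h n k = UV.1 k - UV.2 k
      & forall k, UV.1 k + UV.2 k <= c n].
  have [fn dn _] := hP n; have [fn1 dn1 _] := hP n.+1.
  have [||U [V UV]] := lsc_diff_finite_range (fun k => h n.+1 k - h n k) (c n).
  - exact: (finite_range2 _ _ (fun x y => x - y)).
  (* The increment is [(r - h n) - (r - h n.+1)], so the two bounds add. *)
  - have := lsc_diffD _ _ _ _ dn (lsc_diffN _ _ dn1); congr lsc_diff.
    by apply/funext => k; ring.
  by exists (U, V).
have {UVP} [UV UVP] := choice UVP.
pose U n := (UV n).1; pose V n := (UV n).2.
have lU n : lsc (U n) by have [[]] := UVP n.
have lV n : lsc (V n) by have [[]] := UVP n.
have U0 n k : 0 <= U n k by have [_ [+ _] _ _ _] := UVP n; apply.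
have V0 n k : 0 <= V n k by have [_ [_ +] _ _ _] := UVP n; apply.
have fU n : finite_set (range (U n)) by have [_ _ []] := UVP n.
have fV n : finite_set (range (V n)) by have [_ _ []] := UVP n.
have hE n k : h n.+1 k - h n k = U n k - V n k.
  by have [_ _ _ + _] := UVP n; apply.
have UVc n k : U n k + V n k <= c n by have [_ _ _ _] := UVP n; apply.
have Uc n k : U n k <= c n by have := UVc n k; have := V0 n k; lra.
have Vc n k : V n k <= c n by have := UVc n k; have := U0 n k; lra.
have cU k : cvgn (series (U^~ k)).
  apply: (nneg_series_cvg _ (N + eps)) => // n; apply: le_trans (cS n).
  exact: ler_sum.
have cV k : cvgn (series (V^~ k)).
  apply: (nneg_series_cvg _ (N + eps)) => // n; apply: le_trans (cS n).
  exact: ler_sum.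
have cb : b @ \oo --> (0 : R).
  apply: (@squeeze_cvgr _ _ _ _ (fun=> 0) c); last first.
  - exact: cvg_series_cvg_0 (nneg_series_cvg _ _ c0 cS).
  - exact: cvg_cst.
  - by near=> n; rewrite ltW//= /c lerDl ltW.
have hr k : h n k @[n --> \oo] --> r k.
  apply/cvgrPdist_le => e e0.
  have /cvgrPdist_le/(_ e e0) := cb; apply: filterS => n.
  rewrite sub0r normrN (ger0_norm (ltW (b0 n))) => be; apply: (le_trans _ be).
  by have [_ /(lsc_diff_norm _ _ k)] := hP n.
pose u k := limn (series (U^~ k)); pose v k := limn (series (V^~ k)).
have u0 k : 0 <= u k by apply: (cvg_ge_cst _ _ _ (cU k)) => n; exact: sumr_ge0.
have v0 k : 0 <= v k by apply: (cvg_ge_cst _ _ _ (cV k)) => n; exact: sumr_ge0.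
exists u, v; split.
- by [].
- by split; [apply: (lsc_lim_series U)|apply: (lsc_lim_series V)].
- by split; [apply: (inSD_lim_series U c (N + eps))|
    apply: (inSD_lim_series V c (N + eps))].
- move=> k; rewrite fE; congr (_ %:C); apply: (cvg_unique _ (hr k)) => //.
  (* The increments telescope to [h n - h 0], and [h 0 = 0]. *)
  have -> : (fun n => h n k) = series (U^~ k) - series (V^~ k).
    apply/funext => n; rewrite /series/= -[RHS]sumrB.
    under eq_bigr do rewrite -hE.
    rewrite telescope_sumr//.
    by have [_ _ ->] := hP 0%N; rewrite ?subr0.
  by apply: cvgB; [exact: cU|exact: cV].
- rewrite NE -EFinD; apply: ge_ereal_sup => _ [->|[k _ <-]].
    by rewrite lee_fin addr_ge0// ltW.
  rewrite lee_fin ger0_norm ?addr_ge0//.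
  apply: (cvg_le_cst _ _ _ (cvgD (cU k) (cV k))) => n.
  apply: le_trans (cS n); rewrite /series/= -[leLHS]big_split/=.
  by apply: ler_sum => j _.
Unshelve. all: by end_near. Qed.
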